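(* Let $C<D$, let $\psi_1,\psi_2:[C,D]\to\mathbb{R}$ be $C^1$ with $\psi_1<\psi_2$, and let $a=\{(y,\theta)\in\mathbb{R}\times[C,D]:\psi_1(\theta)\le y\le\psi_2(\theta)\}$. Set $M(\theta)=\max\{|\psi_1'(\theta)|,|\psi_2'(\theta)|\}$. Then for every $C^1$ function $v:\mathbb{R}^2\to\mathbb{R}$, $$\int_{\partial a}|v|\le2\Big\{(D-C)^{-1}+\big|((1+M^2)^{1/2}+2M)/(\psi_2-\psi_1)\big|_\infty\Big\}|1_av|_1+\sqrt2\big((1+|M|_\infty^2)^{1/2}+|M|_\infty\big)|1_a\nabla v|_1.$$
   Context: $\int_{\partial a}$ is with respect to one-dimensional (arclength) Lebesgue measure on $\partial a$; $|1_av|_1=\int_a|v|\,d\lambda_2$ and $|1_a\nabla v|_1=\int_a|\nabla v|\,d\lambda_2$ with $\lambda_2$ two-dimensional Lebesgue measure and $|\nabla v|$ the Euclidean norm of the gradient; $|\cdot|_\infty$ denotes supremum over $\theta\in[C,D]$. *)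

(* Defs.v *)
From HB Require Import structures.
From mathcomp Require Import all_boot all_order all_algebra.
From mathcomp Require Import all_classical all_reals all_analysis.
Set Implicit Arguments. Unset Strict Implicit. Unset Printing Implicit Defensive.
Import Order.TTheory GRing.Theory Num.Theory.
Import numFieldNormedType.Exports.
Local Open Scope classical_set_scope.
Local Open Scope ring_scope.

Definition region (R : realType) (C D : R) (psi1 psi2 : R -> R) : set (R * R) :=
  [set p | p.2 \in `[C, D] /\ psi1 p.2 <= p.1 <= psi2 p.2].

Definition partial_y (R : realType) (v : R * R -> R) (p : R * R) : R :=
  'D_(1, 0) v p.
Definition partial_t (R : realType) (v : R * R -> R) (p : R * R) : R :=
  'D_(0, 1) v p.
Definition grad_norm (R : realType) (v : R * R -> R) (p : R * R) : R :=
  Num.sqrt (partial_y v p ^+ 2 + partial_t v p ^+ 2).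

Definition C1_R2 (R : realType) (v : R * R -> R) : Prop :=
  (forall p, differentiable v p) /\
  continuous (partial_y v) /\ continuous (partial_t v).

Definition C1_on (R : realType) (C D : R) (psi dpsi : R -> R) : Prop :=
  (forall t, t \in `]C, D[ -> is_derive t 1 psi (dpsi t)) /\
  (psi @ at_right C --> psi C) /\ (psi @ at_left D --> psi D) /\
  ((fun h => h^-1 * (psi (C + h) - psi C)) @ at_right 0 --> dpsi C) /\
  ((fun h => h^-1 * (psi (D + h) - psi D)) @ at_left 0 --> dpsi D) /\
  {within `[C, D], continuous dpsi}.

Definition supCD (R : realType) (C D : R) (f : R -> R) : R :=
  sup [set `|f t| | t in `[C, D]].

(* Integral of |v| over the boundary of a, w.r.t. arclength: the boundary
   consists of the two graphs theta |-> (psi_i theta, theta) (arclength element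
   sqrt(1 + psi_i'^2) dtheta) and the two horizontal segments at theta = C, D. *)
Definition boundary_integral (R : realType) (C D : R) (psi1 psi2 dpsi1 dpsi2 : R -> R)
    (v : R * R -> R) : \bar R :=
  ((\int[lebesgue_measure]_(t in `[C, D])
      (`|v (psi1 t, t)| * Num.sqrt (1 + dpsi1 t ^+ 2))%:E) +
   (\int[lebesgue_measure]_(t in `[C, D])
      (`|v (psi2 t, t)| * Num.sqrt (1 + dpsi2 t ^+ 2))%:E) +
   (\int[lebesgue_measure]_(y in `[psi1 C, psi2 C]) (`|v (y, C)|)%:E) +
   (\int[lebesgue_measure]_(y in `[psi1 D, psi2 D]) (`|v (y, D)|)%:E))%E.

(* Main.v *)
Require Import Defs.
From HB Require Import structures.
From mathcomp Require Import all_boot all_order all_algebra.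
From mathcomp Require Import ring lra.
From mathcomp Require Import all_classical all_reals all_analysis.
From mathcomp Require Import measurable_realfun.
Import Order.TTheory GRing.Theory Num.Theory.
Import numFieldNormedType.Exports.
Local Open Scope classical_set_scope.
Local Open Scope ring_scope.

(** A C^1 function f on [a, b] satisfies
      |f a| + |f b| <= 2 / (b - a) * int |f| + int |f'|,
    since |f a| + |f b| <= 2 |f y| + int |f'| for every y, and one averages
    over y.  Applied to y |-> v (y, t) on [psi1 t, psi2 t] and integrated in t
    with weight sqrt (1 + M^2), this bounds the integrals over the two graphs.
    For the two horizontal segments one straightens the strip by
    y = psi1 t + s h t, h = psi2 - psi1, and applies the inequality on [C, D]
    to t |-> v (psi1 t + s h t, t) * h t for each s in [0, 1]; after Tonelli
    the strip is straightened back.  Here |psi1' + s h'| <= M by convexity and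
    |h'| <= 2 M, which is the origin of the 2 M in the statement.  The two
    bounds add up by |x| + |y| <= sqrt 2 * sqrt (x^2 + y^2). *)

Local Notation mu := lebesgue_measure.

(** * Measurability of continuous functions on the plane *)

(** The sigma-algebra on [R * R] is generated by rectangles, not by open sets. The two agree on open
    sets because every open set of the plane is a countable union of rational boxes. *)
Lemma continuous_prod_measurable (R : realType) (f : R * R -> R) :
  continuous f -> measurable_fun [set: R * R] f.
Proof.
move=> /continuousP cf; apply: (measurability _ (RGenOpens.measurableE R)).
move=> _ [_ [a [b ->] <-]]; rewrite setTI.
set U := f @^-1` _.
have oU : open U by apply: cf; exact: interval_open.
(* Boxes have a rational centre and radius [1 / (n + 1)], so they are countably many, and each is a
   product of measurable sets. *)
pose box (q : rat * rat * nat) : set (R * R) :=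
  ball (ratr q.1.1 : R) (q.2.+1%:R^-1) `*` ball (ratr q.1.2 : R) (q.2.+1%:R^-1).
have -> : U = \bigcup_(q in [set q | box q `<=` U]) box q.
  apply/seteqP; split; last by move=> p [q /= qU]; exact: qU.
  move=> p Up.
  have /nbhs_ballP[e /= e0 eU] : nbhs p U by exact: open_nbhs_nbhs.
  (* Two points of one box are within twice its radius in each coordinate, so a radius below [e / 2]
     keeps a box containing [p] inside the [e]-ball around [p]. *)
  have [n ne] : exists n, n.+1%:R^-1 < e / 2.
    exists (Num.truncn (e / 2)^-1); rewrite invf_plt ?posrE ?divr_gt0//.
    exact: truncnS_gt.
  have n0 : 0 < (n.+1%:R^-1 : R) by rewrite invr_gt0.
  have near_rat (x : R) : exists q : rat, ball (ratr q : R) n.+1%:R^-1 x.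
    have [q] : exists q, ratr q \in `]x, (x + n.+1%:R^-1)[.
      by apply: rat_in_itvoo; rewrite ltrDl.
    rewrite in_itv/= => /andP[xq qx]; exists q.
    by rewrite -ball_normE/= ger0_norm ?subr_ge0 ?ltW// ltrBlDl.
  have [[q1 q1p] [q2 q2p]] := (near_rat p.1, near_rat p.2).
  exists ((q1, q2), n) => /=; last by [].
  move=> r [/= r1 r2]; apply: eU; split => /=.
    have := ball_triangle (ball_sym q1p) r1.
    by apply: le_ball; rewrite [leRHS]splitr lerD ?ltW.
  have := ball_triangle (ball_sym q2p) r2.
  by apply: le_ball; rewrite [leRHS]splitr lerD ?ltW.
rewrite bigcup_mkcond; apply: countable_bigcupT_measurable => //.
move=> q; case: ifPn => // _; apply: measurableX; exact: measurable_ball.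
Qed.

(** * Extension by clamping, and suprema over [[C, D]] *)

(* Precomposition with [clamp C D] extends functions given on [C, D] to
   continuous functions on the whole line. *)
Definition clamp {R : realType} (a b t : R) := Num.max a (Num.min b t).

Section clamp.
Context {R : realType}.
Variables a b : R.
Hypothesis ab : a <= b.

Lemma clamp_itv t : clamp a b t \in `[a, b].
Proof. by rewrite in_itv/= /clamp le_max lexx/= ge_max ab ge_min lexx. Qed.

Lemma clamp_id t : t \in `[a, b] -> clamp a b t = t.
Proof. by rewrite in_itv/= /clamp => /andP[at_ tb]; rewrite min_r// max_r. Qed.

Lemma continuous_clamp (f : R -> R) :
  {within `[a, b], continuous f} -> continuous (f \o clamp a b).
Proof.
move=> /subspace_continuousP cf x.
have cx : continuous (clamp a b).
  move=> y; rewrite /clamp.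
  apply: (@continuous_max _ _ (cst a)); first exact: cst_continuous.
  by apply: (@continuous_min _ _ (cst b)) => //; exact: cst_continuous.
(* All values of [clamp a b] lie in [[a, b]], so continuity of [f] within that interval is all that
   the composite sees. *)
apply: (@cvg_trans _ (f @ within `[a, b] (nbhs (clamp a b x)))).
  move=> /= A fA; have := cx x _ fA; rewrite /= !nbhs_simpl/=.
  apply: filterS => y /=; apply; exact: clamp_itv.
by apply: cf; exact: clamp_itv.
Qed.

End clamp.

Lemma C1_on_continuous (R : realType) (C D : R) (psi dpsi : R -> R) :
  C < D -> C1_on C D psi dpsi -> {within `[C, D], continuous psi}.
Proof.
move=> CD [d [cC [cD _]]]; apply/continuous_within_itvP => //; split => //.
move=> t tCD; apply/differentiable_continuous/derivable1_diffP.
by have [] := d t tCD.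
Qed.

(** [sup] bounds its set only when the set is bounded above; the extreme value theorem applied to
    the absolute value provides this. *)
Lemma ler_supCD (R : realType) (C D : R) (f : R -> R) t :
  {within `[C, D], continuous f} -> t \in `[C, D] -> `|f t| <= supCD C D f.
Proof.
move=> cf tCD; have CD : C <= D.
  by move: tCD; rewrite in_itv/= => /andP[]; exact: le_trans.
have [c _ cmax] := EVT_max CD
  (fun x => continuous_comp (cf x) (@norm_continuous _ R (f x))).
apply: ub_le_sup; last by exists t.
by exists `|f c| => _ [x xCD <-]; exact: cmax.
Qed.

(** * One-dimensional inequalities and affine substitution *)

Lemma norm_increment_le (R : realType) (f df : R -> R) (a b : R) : a <= b ->
  continuous f -> continuous df ->
  (forall x, x \in `]a, b[ -> is_derive x 1 f (df x)) ->
  (`|f b - f a|%:E <= \int[lebesgue_measure]_(x in `[a, b]) (`|df x|)%:E)%E.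
Proof.
move=> ab cf cdf fdf.
(* The fundamental theorem of calculus is applied for [a < b]. The degenerate case is kept because
   the inequality is later used up to an intermediate point that may be an endpoint. *)
move: ab; rewrite le_eqVlt => /predU1P[->|ab].
  by rewrite subrr normr0 integral_ge0.
have mdf : measurable_fun `[a, b] (EFin \o df).
  by apply/measurable_EFinP; apply: measurable_funTS; exact: continuous_measurable_fun.
rewrite -[leLHS]/(`|(f b - f a)%:E|)%E.
have <- : (\int[lebesgue_measure]_(x in `[a, b]) (df x)%:E = (f b - f a)%:E)%E.
  rewrite (@continuous_FTC2 _ df f) //.
  - exact: continuous_subspaceT.
  - split.
    + by move=> x xab; have [] := fdf x xab.
    + by apply: cvg_at_right_filter; exact: cf.
    + by apply: cvg_at_left_filter; exact: cf.
  - by move=> x xab; rewrite derive1E; have [] := fdf x xab.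
by apply: le_abse_integral.
Qed.

Lemma norm_endpoints_le (R : realType) (f df : R -> R) (a b : R) : a < b ->
  continuous f -> continuous df ->
  (forall x, x \in `]a, b[ -> is_derive x 1 f (df x)) ->
  ((`|f a| + `|f b|)%:E <=
   \int[lebesgue_measure]_(x in `[a, b]) (2 / (b - a) * `|f x| + `|df x|)%:E)%E.
Proof.
move=> ab cf cdf fdf.
have mabs (g : R -> R) (A : set R) : continuous g ->
    measurable_fun A (EFin \o (fun x => `|g x|)).
  move=> cg; apply/measurable_EFinP/measurable_funTS.
  by apply: measurableT_comp => //; exact: continuous_measurable_fun.
have ba0 : 0 < b - a by rewrite subr_gt0.
have [I IE] : exists I, (I = \int[mu]_(x in `[a, b]) `|df x|%:E)%E.
  by exists (\int[mu]_(x in `[a, b]) `|df x|%:E)%E.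
(* Cutting at [y], the increment of [f] to the left is charged to one piece of [I] and the increment
   to the right to the other, so [I] is paid only once. *)
have pointwise y : y \in `[a, b] ->
    ((`|f a| + `|f b|)%:E <= 2%:E * `|f y|%:E + I)%E.
  rewrite in_itv/= => /andP[ay yb].
  have -> : I = (\int[mu]_(x in `[a, y]) (`|df x|)%:E +
                 \int[mu]_(x in `[y, b]) (`|df x|)%:E)%E.
    rewrite IE (@itv_bndbnd_setU _ _ (BLeft a) (BRight y))//.
    rewrite ge0_integral_setU//=; last 2 first.
      exact: mabs.
      apply/disj_set2P; rewrite -subset0 => x /=.
      by rewrite !in_itv/= => -[/andP[_ xy] /andP[+ _]]; rewrite ltNge xy.
    by congr (_ + _)%E; rewrite integral_itv_obnd_cbnd//; exact: mabs.
  have day x : x \in `]a, y[ -> is_derive x 1 f (df x).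
    rewrite in_itv/= => /andP[ax xy].
    by apply: fdf; rewrite in_itv/= ax (lt_le_trans xy).
  have dyb x : x \in `]y, b[ -> is_derive x 1 f (df x).
    rewrite in_itv/= => /andP[yx xb].
    by apply: fdf; rewrite in_itv/= xb andbT (le_lt_trans ay).
  have ya := @norm_increment_le R f df a y ay cf cdf day.
  have yb' := @norm_increment_le R f df y b yb cf cdf dyb.
  apply: (@le_trans _ _ (2%:E * `|f y|%:E +
      (`|f y - f a|%:E + `|f b - f y|%:E))%E).
    rewrite -!EFinM -!EFinD lee_fin.
    have := ler_distD 0 (f a) (f y); have := ler_normB (f a) (f y).
    have := lerB_dist (f a) (f y); have := lerB_dist (f b) (f y).
    rewrite (distrC (f a)); lra.
  by apply: leeD2l; apply: leeD.
have cstE (k : \bar R) : (\int[mu]_(_ in `[a, b]) k = k * (b - a)%:E)%E.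
  transitivity (k * mu `[a, b]%classic)%E; first exact: integral_cst.
  by rewrite lebesgue_measure_itv/= lte_fin ab.
have I0 : (0 <= I)%E by rewrite IE; apply: integral_ge0.
(* Averaging over [y]: the constant terms acquire a factor [b - a], which is removed at the end by
   multiplying with its inverse in the extended reals. *)
have : (\int[mu]_(y in `[a, b]) (`|f a| + `|f b|)%:E <=
        \int[mu]_(y in `[a, b]) (2%:E * `|f y|%:E + I))%E.
  apply: ge0_le_integral.
  - exact: measurable_itv.
  - by move=> x _; rewrite lee_fin addr_ge0.
  - exact: measurable_cst.
  - apply: emeasurable_funD; last exact: measurable_cst.
    by apply: measurable_funeM; exact: mabs.
  - exact: pointwise.
rewrite !cstE ge0_integralD//=; last first.
  by apply: measurable_funeM; exact: mabs.
rewrite cstE ge0_integralZl_EFin//; last exact: mabs.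
move=> h.
have -> : (\int[mu]_(x in `[a, b]) (2 / (b - a) * `|f x| + `|df x|)%:E =
    (2 / (b - a))%:E * \int[mu]_(x in `[a, b]) `|f x|%:E + I)%E.
  transitivity (\int[mu]_(x in `[a, b])
      ((2 / (b - a))%:E * `|f x|%:E + `|df x|%:E))%E; first by [].
  rewrite ge0_integralD//=; last 3 first.
  - by move=> x _; rewrite -EFinM lee_fin mulr_ge0// divr_ge0// ltW.
  - by apply: measurable_funeM; exact: mabs.
  - exact: mabs.
  by rewrite ge0_integralZl_EFin ?IE//; [exact: mabs|rewrite divr_ge0// ltW].
have bai0 : (0 <= (b - a)^-1%:E :> \bar R)%E by rewrite lee_fin invr_ge0 ltW.
have J0 : (0 <= \int[mu]_(x in `[a, b]) `|f x|%:E)%E by apply: integral_ge0.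
have bb : ((b - a)%:E * (b - a)^-1%:E = 1 :> \bar R)%E.
  by rewrite -EFinM divff// gt_eqF.
have := lee_wpmul2r bai0 h.
rewrite ge0_muleDl ?mule_ge0 ?lee_fin//; try exact: ltW.
rewrite -!muleA bb !mule1.
by rewrite [(_ * (b - a)^-1%:E)%E]muleC muleA -EFinM.
Qed.

(** The substitution y = a + s (b - a) brings fibres of varying position and length to the common
    interval [0, 1], so that the order of integration can be exchanged. *)
Lemma integral_itv01 (R : realType) (f : R -> R) (a b : R) : a < b ->
  continuous f ->
  (\int[lebesgue_measure]_(y in `[a, b]) (f y)%:E =
   \int[lebesgue_measure]_(s in `[0%R, 1%R]) (f (a + s * (b - a)) * (b - a))%:E)%E.
Proof.
move=> ab cf; have ba0 : 0 < b - a by rewrite subr_gt0.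
pose F (s : R) := a + s * (b - a).
have dF (x : R) : is_derive x 1 F (b - a).
  have := is_deriveD (is_derive_cst a x 1)
    (is_deriveZ (b - a) (is_derive_id x 1)).
  rewrite add0r /GRing.scale/= mulr1; congr (is_derive _ _ _ _).
  by apply/funext => s; rewrite /F mulrC.
have F'E : derive1 F = cst (b - a).
  by apply/funext => x; rewrite derive1E; have [] := dF x.
have cF : continuous F.
  by move=> x; apply/differentiable_continuous/derivable1_diffP; have [] := dF x.
have := @integration_by_substitution_increasing R F f 0 1 ler01.
rewrite /F mul0r addr0 mul1r subrKC -/F => ->//.
- by apply: eq_integral => s _; rewrite F'E.
- by move=> x y _ _ xy; rewrite /F ltrD2l ltr_pM2r.
- by rewrite F'E => x _; exact: cst_continuous.
- by rewrite F'E; exact: is_cvg_cst.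
- by rewrite F'E; exact: is_cvg_cst.
- split.
  + by move=> x _; have [] := dF x.
  + by apply: cvg_at_right_filter; exact: cF.
  + by apply: cvg_at_left_filter; exact: cF.
- exact: continuous_subspaceT.
Qed.

(** * Tonelli's theorem on the strip and on rectangles *)

Section region.
Context {R : realType}.
Variables (C D : R) (p1 p2 : R -> R).
Hypotheses (cp1 : continuous p1) (cp2 : continuous p2).

Lemma measurable_region : measurable (region C D p1 p2).
Proof.
have mcond (g : R * R -> R) : continuous g -> measurable [set p | 0 <= g p].
  move=> cg; rewrite -[X in measurable X]setTI.
  have -> : [set p | 0 <= g p] = g @^-1` `[0, +oo[.
    by apply/seteqP; split => p /=; rewrite in_itv/= andbT.
  by apply: (continuous_prod_measurable _ g).
have csnd (h : R -> R) : continuous h -> continuous (fun p : R * R => h p.2).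
  by move=> ch p; apply: continuous_comp; [exact: cvg_snd|exact: ch].
have cfst : continuous (fun p : R * R => p.1) by move=> p; exact: cvg_fst.
have -> : region C D p1 p2 =
    [set p | 0 <= p.2 - C] `&` [set p | 0 <= D - p.2] `&`
    ([set p | 0 <= p.1 - p1 p.2] `&` [set p | 0 <= p2 p.2 - p.1]).
  apply/seteqP; split => p; rewrite /region /= in_itv/= !subr_ge0.
    by move=> [/andP[-> ->] /andP[-> ->]].
  by move=> [[-> ->] [-> ->]].
do 2!apply: measurableI; apply: mcond => p; apply: continuousB.
- exact: cvg_snd.
- exact: cst_continuous.
- exact: cst_continuous.
- exact: cvg_snd.
- exact: cfst.
- exact: csnd.
- exact: csnd.
- exact: cfst.
Qed.

Variable f : R * R -> R.
Hypotheses (cf : continuous f) (f0 : forall p, 0 <= f p).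

Let g : R * R -> \bar R := (EFin \o f) \_ (region C D p1 p2).

Let mg : measurable_fun [set: R * R] g.
Proof.
apply/(measurable_restrictT _ _).1; first exact: measurable_region.
by apply: measurable_funTS; apply/measurable_EFinP; exact: continuous_prod_measurable.
Qed.

Let g0 p : (0 <= g p)%E.
Proof. by rewrite /g patchE; case: ifPn => // _; rewrite lee_fin. Qed.

(** The inner integral runs over the whole line in the first coordinate; the extension by zero cuts
    it down to the fibre over [t], and makes it vanish for [t] outside [[C, D]]. Both the iterated
    integral and its measurability follow from this identity. *)
Let gE : fubini_G mu g =
  (fun t => \int[mu]_(y in `[p1 t, p2 t]) (f (y, t))%:E)%E \_ `[C, D].
Proof.
apply/funext => t; rewrite /fubini_G patchE; case: ifPn => tCD.
  rewrite [RHS]integral_mkcond; apply: eq_integral => y _.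
  rewrite /g !patchE; congr (if _ then _ else _).
  apply/idP/idP; rewrite !inE /region/= !in_itv/=; first by case.
  by move: tCD; rewrite inE/= in_itv.
apply: integral0_eq => y _; rewrite /g patchE ifF//; apply/negbTE.
by apply: contra tCD; rewrite !inE /region/= => -[].
Qed.

Lemma integral_region :
  (\int[mu \x mu]_(p in region C D p1 p2) (f p)%:E =
   \int[mu]_(t in `[C, D]) \int[mu]_(y in `[p1 t, p2 t]) (f (y, t))%:E)%E.
Proof.
by rewrite integral_mkcond [RHS]integral_mkcond -gE -fubini_tonelli2.
Qed.

Lemma measurable_integral_section :
  measurable_fun `[C, D]
    (fun t => \int[mu]_(y in `[p1 t, p2 t]) (f (y, t))%:E)%E.
Proof.
apply/(measurable_restrictT _ _).2 => //; rewrite -gE.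
exact: measurable_fun_fubini_tonelli_G.
Qed.

End region.

Lemma tonelli_itv (R : realType) (a b c d : R) (f : R * R -> R) :
  continuous f -> (forall p, 0 <= f p) ->
  (\int[mu]_(s in `[a, b]) \int[mu]_(t in `[c, d]) (f (s, t))%:E =
   \int[mu]_(t in `[c, d]) \int[mu]_(s in `[a, b]) (f (s, t))%:E)%E.
Proof.
move=> cf f0.
pose g : R * R -> \bar R := (EFin \o f) \_ (`[a, b] `*` `[c, d]).
have mg : measurable_fun [set: R * R] g.
  apply/(measurable_restrictT _ _).1; first exact: measurableX.
  by apply: measurable_funTS; apply/measurable_EFinP; exact: continuous_prod_measurable.
have g0 p : (0 <= g p)%E.
  by rewrite /g patchE; case: ifPn => // _; rewrite lee_fin.
transitivity (\int[mu]_s \int[mu]_t g (s, t))%E.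
  rewrite integral_mkcond; apply: eq_integral => s _.
  rewrite patchE; case: ifPn => sab; last first.
    rewrite integral0_eq// => t _; rewrite /g patchE ifF//; apply/negbTE.
    by apply: contra sab; rewrite !inE => -[].
  rewrite integral_mkcond; apply: eq_integral => t _.
  rewrite /g !patchE; congr (if _ then _ else _).
  apply/idP/idP; rewrite !inE /=; last by case.
  by move: sab; rewrite inE.
transitivity (\int[mu]_t \int[mu]_s g (s, t))%E.
  by have := @fubini_tonelli _ _ _ _ R mu mu g mg g0.
rewrite [RHS]integral_mkcond.
apply: eq_integral => t _; rewrite patchE; case: ifPn => tcd; last first.
  rewrite integral0_eq// => s _; rewrite /g patchE ifF//; apply/negbTE.
  by apply: contra tcd; rewrite !inE => -[].
rewrite [RHS]integral_mkcond; apply: eq_integral => s _.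
rewrite /g !patchE; congr (if _ then _ else _).
apply/idP/idP; rewrite !inE /=; first by case.
by move: tcd; rewrite inE.
Qed.

(** * Chain rule along curves and continuity of composites *)

Lemma is_derive_curve (R : realType) (v : R * R -> R) (x y : R -> R)
    (t dx dy : R) :
  differentiable v (x t, y t) ->
  is_derive t 1 x dx -> is_derive t 1 y dy ->
  is_derive t 1 (fun t => v (x t, y t))
    (dx * partial_y v (x t, y t) + dy * partial_t v (x t, y t)).
Proof.
move=> dv [/derivable1_diffP dfx Dx] [/derivable1_diffP dfy Dy].
have dc : differentiable (fun t => (x t, y t)) t by exact: differentiable_pair.
have dvc : differentiable (v \o (fun t => (x t, y t))) t.
  exact: differentiable_comp.
split; first exact: diff_derivable.
rewrite deriveE// diff_comp//= diff_pair//= -!deriveE// Dx Dy.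
rewrite /partial_y /partial_t !deriveE//.
(* Linearity of the differential splits the velocity into coordinate directions, which yields the
   partial derivatives. *)
have -> : (dx, dy) = dx *: ((1, 0) : R * R) + dy *: ((0, 1) : R * R).
  by congr pair; rewrite /= /GRing.scale/= ?mulr1 ?mulr0 ?addr0 ?add0r.
by rewrite linearD !linearZ.
Qed.

Lemma continuous_pair_comp (R : realType) (T : topologicalType)
    (f : R * R -> R) (x y : T -> R) :
  continuous f -> continuous x -> continuous y ->
  continuous (fun t => f (x t, y t)).
Proof.
move=> cf cx cy t; apply: (@continuous_comp _ _ _ (fun t => (x t, y t)) f).
  exact: (cvg_pair (cx t) (cy t)).
exact: cf.
Qed.

Lemma continuous_sqrt_comp (R : realType) (T : topologicalType) (f : T -> R) :
  continuous f -> continuous (fun x => Num.sqrt (f x)).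
Proof. by move=> cf x; apply: continuous_comp; [exact: cf|exact: sqrt_continuous]. Qed.

Lemma continuous_norm_comp (R : realType) (T : topologicalType) (f : T -> R) :
  continuous f -> continuous (fun x => `|f x|).
Proof. by move=> cf x; apply: continuous_comp; [exact: cf|exact: norm_continuous]. Qed.

Lemma continuous_snd_comp (R : realType) (f : R -> R) :
  continuous f -> continuous (fun p : R * R => f p.2).
Proof. by move=> cf p; apply: continuous_comp; [exact: cvg_snd|exact: cf]. Qed.

Lemma continuousD_fun (R : realType) (T : topologicalType) (f g : T -> R) :
  continuous f -> continuous g -> continuous (fun x => f x + g x).
Proof. by move=> cf cg x; apply: continuousD; [exact: cf|exact: cg]. Qed.

Lemma continuousB_fun (R : realType) (T : topologicalType) (f g : T -> R) :
  continuous f -> continuous g -> continuous (fun x => f x - g x).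
Proof. by move=> cf cg x; apply: continuousB; [exact: cf|exact: cg]. Qed.

Lemma continuousM_fun (R : realType) (T : topologicalType) (f g : T -> R) :
  continuous f -> continuous g -> continuous (fun x => f x * g x).
Proof. by move=> cf cg x; apply: continuousM; [exact: cf|exact: cg]. Qed.

Lemma continuousV_fun (R : realType) (T : topologicalType) (f : T -> R) :
  continuous f -> (forall x, f x != 0) -> continuous (fun x => (f x)^-1).
Proof. by move=> cf f0 x; apply: continuousV; [exact: f0|exact: cf]. Qed.

Lemma continuousX_fun (R : realType) (T : topologicalType) (f : T -> R) n :
  continuous f -> continuous (fun x => f x ^+ n).
Proof.
move=> cf x; apply: (@continuous_comp _ _ _ f (fun y => y ^+ n)); first exact: cf.
exact: exprn_continuous.
Qed.

Lemma continuous_cst (R : realType) (T : topologicalType) (c : R) :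
  continuous (fun _ : T => c).
Proof. by move=> x; exact: cst_continuous. Qed.

Lemma continuous_fst (R : realType) : continuous (fun p : R * R => p.1).
Proof. by move=> p; exact: cvg_fst. Qed.

Lemma continuous_snd (R : realType) : continuous (fun p : R * R => p.2).
Proof. by move=> p; exact: cvg_snd. Qed.

Lemma continuous_idfun (R : realType) : continuous (fun x : R => x).
Proof. by move=> x; exact: cvg_id. Qed.

(** Recursion on the shape of the body. Subtraction is tried before addition because [x - y] is
    itself a sum [x + - y]. Nonvanishing of a denominator must be available in the context. *)
Ltac cont :=
  lazymatch goal with
  | |- continuous (fun _ => ?c) => refine (@continuous_cst _ _ c)
  | |- continuous (fun _ => _ - _) => refine (continuousB_fun _ _ _ _ _ _); cont
  | |- continuous (fun _ => _ + _) => refine (continuousD_fun _ _ _ _ _ _); cont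
  | |- continuous (fun _ => _ * _) => refine (continuousM_fun _ _ _ _ _ _); cont
  | |- continuous (fun _ => `|_|) => refine (continuous_norm_comp _ _ _ _); cont
  | |- continuous (fun _ => Num.sqrt _) => refine (continuous_sqrt_comp _ _ _ _); cont
  | |- continuous (fun _ => _ ^-1) =>
      refine (continuousV_fun _ _ _ _ _); [cont|assumption]
  | |- continuous (fun _ => _ ^+ _) => refine (continuousX_fun _ _ _ _ _); cont
  | |- continuous (fun x => x) => refine (@continuous_idfun _)
  | |- continuous (fun x => x.1) => refine (@continuous_fst _)
  | |- continuous (fun x => x.2) => refine (@continuous_snd _)
  | |- continuous fst => refine (@continuous_fst _)
  | |- continuous snd => refine (@continuous_snd _)
  | |- continuous (fun x => ?f (_, _)) =>
      refine (@continuous_pair_comp _ _ f _ _ _ _ _); [assumption|cont|cont]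
  | |- continuous (fun x => ?f (x.2)) =>
      refine (@continuous_snd_comp _ f _); assumption
  | |- _ => assumption
  end.

(** * Boundary estimates for a strip between two graphs *)

Section curved_strip.
Context {R : realType}.
Variables (C D : R) (p1 p2 d1 d2 m : R -> R) (v : R * R -> R).
Hypotheses (CD : C < D).
Hypotheses (cp1 : continuous p1) (cp2 : continuous p2).
Hypotheses (cd1 : continuous d1) (cd2 : continuous d2) (cm : continuous m).
Hypotheses (p1d : forall t, t \in `]C, D[ -> is_derive t 1 p1 (d1 t)).
Hypotheses (p2d : forall t, t \in `]C, D[ -> is_derive t 1 p2 (d2 t)).
Hypotheses (p12 : forall t, p1 t < p2 t).
Hypotheses (d1m : forall t, `|d1 t| <= m t) (d2m : forall t, `|d2 t| <= m t).
Variables vy vt : R * R -> R.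
Hypotheses (vyE : vy = partial_y v) (vtE : vt = partial_t v).
Hypothesis dv : forall p, differentiable v p.
Hypotheses (cvy : continuous vy) (cvt : continuous vt).

Let cv : continuous v.
Proof. by move=> p; exact/differentiable_continuous/dv. Qed.
Let h0 t : 0 < p2 t - p1 t. Proof. by rewrite subr_gt0. Qed.
Let hn0 (p : R * R) : p2 p.2 - p1 p.2 != 0. Proof. exact: lt0r_neq0. Qed.

(** The integrand of the endpoint inequality on a horizontal fibre, weighted by a common upper bound
    for the arclength factors of both graphs. *)
Definition graph_density (p : R * R) : R :=
  Num.sqrt (1 + m p.2 ^+ 2) * (2 / (p2 p.2 - p1 p.2) * `|v p| + `|vy p|).

(** An upper bound for the endpoint integrand along a straightened curve, divided by the Jacobian h
    = p2 - p1. The summand with [2 * m] over h comes from differentiating that Jacobian. *)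
Definition segment_density (p : R * R) : R :=
  (2 / (D - C) + 2 * m p.2 / (p2 p.2 - p1 p.2)) * `|v p| +
  m p.2 * `|vy p| + `|vt p|.

Lemma continuous_graph_density : continuous graph_density.
Proof. unfold graph_density; cont. Qed.

Lemma continuous_segment_density : continuous segment_density.
Proof. unfold segment_density; cont. Qed.

Let m0 t : 0 <= m t. Proof. exact: le_trans (d1m t). Qed.

Lemma graph_density_ge0 p : 0 <= graph_density p.
Proof.
by rewrite /graph_density mulr_ge0 ?sqrtr_ge0// addr_ge0// mulr_ge0// divr_ge0// ltW.
Qed.

Lemma segment_density_ge0 p : 0 <= segment_density p.
Proof.
rewrite /segment_density !addr_ge0// mulr_ge0// addr_ge0//.
  by rewrite divr_ge0// subr_ge0 ltW.
by rewrite divr_ge0 ?mulr_ge0// ltW.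
Qed.

Lemma graph_integral_le :
  (\int[mu]_(t in `[C, D]) (`|v (p1 t, t)| * Num.sqrt (1 + d1 t ^+ 2))%:E +
   \int[mu]_(t in `[C, D]) (`|v (p2 t, t)| * Num.sqrt (1 + d2 t ^+ 2))%:E <=
   \int[mu \x mu]_(p in region C D p1 p2) (graph_density p)%:E)%E.
Proof.
have mcont (f : R -> R) (A : set R) : continuous f -> measurable_fun A (EFin \o f).
  move=> cf; apply/measurable_EFinP/measurable_funTS.
  exact: continuous_measurable_fun.
have mE (p d : R -> R) : continuous p -> continuous d ->
    measurable_fun `[C, D]
      (fun t => (`|v (p t, t)| * Num.sqrt (1 + d t ^+ 2))%:E).
  by move=> cp cd; apply: mcont; cont.
rewrite -ge0_integralD//; try exact: mE.
rewrite integral_region//; last 2 first.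
- exact: continuous_graph_density.
- exact: graph_density_ge0.
apply: ge0_le_integral => //.
- by move=> t _; rewrite -EFinD lee_fin addr_ge0// mulr_ge0.
- by apply: emeasurable_funD; exact: mE.
- apply: measurable_integral_section => //.
    exact: continuous_graph_density.
  exact: graph_density_ge0.
move=> t _; set w := Num.sqrt (1 + m t ^+ 2).
have w0 : 0 <= w by exact: sqrtr_ge0.
have sw (d : R) : `|d| <= m t -> Num.sqrt (1 + d ^+ 2) <= w.
  move=> dm; rewrite ler_wsqrtr// lerD2l -[d ^+ 2]real_normK ?num_real//.
  by rewrite lerXn2r// nnegrE.
(* The two ends of the fibre over [t] are exactly the points of the two graphs at [t]. *)
have ep := @norm_endpoints_le R (fun y => v (y, t)) (fun y => vy (y, t))
  (p1 t) (p2 t) (p12 t).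
have {}ep : ((`|v (p1 t, t)| + `|v (p2 t, t)|)%:E <=
    \int[mu]_(y in `[p1 t, p2 t])
      (2 / (p2 t - p1 t) * `|v (y, t)| + `|vy (y, t)|)%:E)%E.
  apply: ep; [by cont|by cont|move=> y _].
  have := is_derive_curve R v id (cst t) y 1 0 (dv (y, t))
    (is_derive_id y 1) (is_derive_cst t y 1).
  by rewrite vyE mul1r mul0r addr0.
apply: (@le_trans _ _ (w%:E * (`|v (p1 t, t)| + `|v (p2 t, t)|)%:E)%E).
  rewrite -EFinM -EFinD lee_fin mulrDr lerD// mulrC ler_wpM2r//.
  - exact: sw.
  - exact: sw.
apply: (@le_trans _ _ (w%:E * \int[mu]_(y in `[p1 t, p2 t])
      (2 / (p2 t - p1 t) * `|v (y, t)| + `|vy (y, t)|)%:E)%E).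
  by rewrite lee_wpmul2l ?lee_fin.
rewrite -ge0_integralZl_EFin//.
- by move=> y _; rewrite lee_fin addr_ge0// mulr_ge0// divr_ge0// ltW.
- by apply: mcont; cont.
Qed.

(** For fixed [s] this is [v] along the curve dividing each fibre in the ratio s : 1 - s, times the
    Jacobian of the straightening. With the Jacobian included, integration over [s] returns the
    integral over the fibre. [dg] is its derivative in [t], and [G] the resulting endpoint integrand
    on [[C, D]]. *)
Let g s t := v (p1 t + s * (p2 t - p1 t), t) * (p2 t - p1 t).
Let dg s t :=
  ((d1 t + s * (d2 t - d1 t)) * vy (p1 t + s * (p2 t - p1 t), t) +
   vt (p1 t + s * (p2 t - p1 t), t)) * (p2 t - p1 t) +
  v (p1 t + s * (p2 t - p1 t), t) * (d2 t - d1 t).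
Let G (p : R * R) := 2 / (D - C) * `|g p.1 p.2| + `|dg p.1 p.2|.

Let cG : continuous G. Proof. unfold G, g, dg; cont. Qed.
Let G0 p : 0 <= G p.
Proof. by rewrite addr_ge0// mulr_ge0// divr_ge0// subr_ge0 ltW. Qed.

Let gdg s t : t \in `]C, D[ -> is_derive t 1 (g s) (dg s t).
Proof.
move=> tCD; have [D1 D2] := (p1d t tCD, p2d t tCD).
have Dh := is_deriveB D2 D1.
have Dc := is_deriveD D1 (is_deriveZ s Dh).
have H := is_deriveM (is_derive_curve R v _ id t _ 1 (dv _) Dc (is_derive_id t 1)) Dh.
refine (is_derive_eq H _).
rewrite -vyE -vtE /dg mul1r /GRing.scale/= addrC; congr (_ + _); exact: mulrC.
Qed.

Let G_le s t : s \in `[0, 1] ->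
  G (s, t) <= segment_density (p1 t + s * (p2 t - p1 t), t) * (p2 t - p1 t).
Proof.
rewrite in_itv/= => /andP[s0 s1]; rewrite /G /segment_density /g /dg /=.
set q := (_, t); set h := p2 t - p1 t.
have hh : 0 < h by exact: h0.
(* Over the common denominator h the Jacobian cancels, leaving three terms to compare with those of
   [G]; the term [2 * m t] keeps no factor h. *)
have -> : (2 / (D - C) + 2 * m t / h) * `|v q| + m t * `|vy q| + `|vt q| =
    (2 / (D - C) * `|v q| * h + ((m t * `|vy q| + `|vt q|) * h +
     2 * m t * `|v q|)) / h.
  by field; rewrite gt_eqF// gt_eqF// subr_gt0.
rewrite divfK ?gt_eqF// normrM (gtr0_norm hh) mulrA lerD2l.
apply: (le_trans (ler_normD _ _)); apply: lerD.
  rewrite normrM (gtr0_norm hh) ler_wpM2r ?(ltW hh)//.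
  apply: (le_trans (ler_normD _ _)); rewrite lerD2r normrM ler_wpM2r//.
  (* The slope of the intermediate curve is a convex combination of [d1 t] and [d2 t]; [m t] is
     split below with the same weights. *)
  have -> : d1 t + s * (d2 t - d1 t) = (1 - s) * d1 t + s * d2 t by ring.
  apply: (le_trans (ler_normD _ _)); rewrite !normrM (ger0_norm s0).
  rewrite ger0_norm ?subr_ge0// -[leRHS](subrK (s * m t)).
  apply: lerD; last by rewrite ler_wpM2l.
  by rewrite -[X in _ <= X - _]mul1r -mulrBl ler_wpM2l// subr_ge0.
rewrite normrM mulrC ler_wpM2r// (le_trans (ler_normB _ _))//.
by rewrite mulr_natl mulr2n lerD.
Qed.

Lemma segment_integral_le :
  (\int[mu]_(y in `[p1 C, p2 C]) `|v (y, C)|%:E +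
   \int[mu]_(y in `[p1 D, p2 D]) `|v (y, D)|%:E <=
   \int[mu \x mu]_(p in region C D p1 p2) (segment_density p)%:E)%E.
Proof.
have mcont (f : R -> R) (A : set R) : continuous f -> measurable_fun A (EFin \o f).
  move=> cf; apply/measurable_EFinP/measurable_funTS.
  exact: continuous_measurable_fun.
have cvg_ t : continuous (fun y => `|v (y, t)|) by cont.
have cgs t : continuous (fun s => `|g s t|) by unfold g; cont.
(* After this both end segments are integrals over the same [s], so they can be added under one
   integral sign as the end values of [g s]. *)
have toI t : (\int[mu]_(y in `[p1 t, p2 t]) `|v (y, t)|%:E =
    \int[mu]_(s in `[0%R, 1%R]) `|g s t|%:E)%E.
  rewrite (integral_itv01 R (fun y => `|v (y, t)|) _ _ (p12 t) (cvg_ t)).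
  by apply: eq_integral => s _; rewrite /g normrM (gtr0_norm (h0 t)).
rewrite !toI -ge0_integralD//; try by apply: mcont.
apply: (@le_trans _ _ (\int[mu]_(s in `[0%R, 1%R])
    \int[mu]_(t in `[C, D]) (G (s, t))%:E)%E).
  apply: ge0_le_integral.
  - exact: measurable_itv.
  - by move=> s _; rewrite -EFinD lee_fin addr_ge0.
  - by apply: emeasurable_funD; apply: mcont.
  (* A rectangle is a region with constant bounding graphs. The coordinates of [G] are swapped
     because fibres of a region run along the first coordinate, whereas here [t] is integrated
     first. *)
  - apply: (measurable_integral_section 0 1 (cst C) (cst D) _ _
      (fun p => G (p.2, p.1))) => //; [| |cont].
      exact: continuous_cst.
    exact: continuous_cst.
  - move=> s _; apply: (norm_endpoints_le R (g s) (dg s) C D CD).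
    + by unfold g; cont.
    + by unfold dg; cont.
    + by move=> t; exact: gdg.
rewrite (tonelli_itv R 0 1 C D G cG G0) integral_region//; last 2 first.
- exact: continuous_segment_density.
- exact: segment_density_ge0.
apply: ge0_le_integral.
- exact: measurable_itv.
- by move=> t _; apply: integral_ge0 => s _; rewrite lee_fin.
- apply: (measurable_integral_section C D (cst 0) (cst 1) _ _ G) => //.
    exact: continuous_cst.
  exact: continuous_cst.
- apply: measurable_integral_section => //.
    exact: continuous_segment_density.
  exact: segment_density_ge0.
(* Straightening the right-hand fibre produces the factor h demanded by [G_le], which then applies
   pointwise in [s]. *)
move=> t _; rewrite (integral_itv01 R (fun y => segment_density (y, t))) //.
  apply: ge0_le_integral.
  - exact: measurable_itv.
  - by move=> s _; rewrite lee_fin.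
  - apply: mcont; apply: (continuous_pair_comp R R G id (cst t) cG).
      exact: continuous_idfun.
    exact: continuous_cst.
  - apply: mcont.
    apply: (continuousM_fun R R (fun s => segment_density (p1 t + s * (p2 t - p1 t), t))).
      apply: continuous_pair_comp; [exact: continuous_segment_density|cont|cont].
    exact: continuous_cst.
  - by move=> s s01; rewrite lee_fin; exact: G_le.
apply: continuous_pair_comp; [exact: continuous_segment_density|cont|cont].
Qed.

End curved_strip.

(** * Pointwise comparison of the densities with the final integrand *)

(** After squaring, the difference of the two sides is the square of |x| - |y|. *)
Lemma norm1_le_sqrt2_norm2 (R : realType) (x y : R) :
  `|x| + `|y| <= Num.sqrt 2 * Num.sqrt (x ^+ 2 + y ^+ 2).
Proof.
rewrite -sqrtrM// -[leLHS]ger0_norm ?addr_ge0// -sqrtr_sqr ler_wsqrtr//.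
rewrite -[x ^+ 2]real_normK ?num_real// -[y ^+ 2]real_normK ?num_real//.
by rewrite -subr_ge0 (_ : _ - _ = (`|x| - `|y|) ^+ 2) ?sqr_ge0//; ring.
Qed.

(** The sum of the densities has coefficient 2 ((D - C)^-1 + (k + m) / h) on |v|, where k = sqrt (1
    + m^2) and h = p2 - p1; since m >= 0, enlarging k + m to k + 2 m brings [S] in. The derivatives
    carry k + m and 1, both raised to the common value [K + T] before passing to the Euclidean
    norm. *)
Lemma density_le (R : realType) (C D S T : R) (p1 p2 m : R -> R)
    (v vy vt : R * R -> R) (p : R * R) :
  p1 p.2 < p2 p.2 -> 0 <= m p.2 -> m p.2 <= T ->
  (Num.sqrt (1 + m p.2 ^+ 2) + 2 * m p.2) / (p2 p.2 - p1 p.2) <= S ->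
  graph_density p1 p2 m v vy p + segment_density C D p1 p2 m v vy vt p <=
  2 * ((D - C)^-1 + S) * `|v p| +
  Num.sqrt 2 * (Num.sqrt (1 + T ^+ 2) + T) *
    Num.sqrt (vy p ^+ 2 + vt p ^+ 2).
Proof.
rewrite /graph_density /segment_density.
set k := Num.sqrt (1 + m p.2 ^+ 2); set mp := m p.2.
move=> p12 m0 mT; rewrite -subr_gt0 in p12.
set hi := (p2 p.2 - p1 p.2)^-1 => HS.
have hi0 : 0 <= hi by rewrite invr_ge0 ltW.
have K1 : 1 <= Num.sqrt (1 + T ^+ 2) by rewrite -[leLHS]sqrtr1 ler_wsqrtr// lerDl sqr_ge0.
have kK : k <= Num.sqrt (1 + T ^+ 2).
  by rewrite ler_wsqrtr// lerD2l lerXn2r// nnegrE// (le_trans m0).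
have T0 : 0 <= T by exact: le_trans mT.
set K := Num.sqrt (1 + T ^+ 2) in K1 kK *.
have n12 := norm1_le_sqrt2_norm2 R (vy p) (vt p).
set N := Num.sqrt (vy p ^+ 2 + _) in n12 *.
have -> : k * (2 * hi * `|v p| + `|vy p|) +
   ((2 * (D - C)^-1 + 2 * mp * hi) * `|v p| + mp * `|vy p| + `|vt p|) =
   2 * ((D - C)^-1 + (k + mp) * hi) * `|v p| +
   ((k + mp) * `|vy p| + `|vt p|) by ring.
apply: lerD.
  rewrite ler_wpM2r// ler_wpM2l// lerD2l (le_trans _ HS)// ler_wpM2r//.
  by rewrite lerD2l ler_peMl// ler1n.
apply: (@le_trans _ _ ((K + T) * (`|vy p| + `|vt p|))).
  rewrite mulrDr lerD//; first by rewrite ler_wpM2r// lerD.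
  (* The coefficient 1 of |vt| is at most [K + T] because [K] is at least 1. *)
  by rewrite ler_peMl// (le_trans K1)// lerDl.
rewrite -mulrA mulrCA ler_wpM2l//.
by rewrite addr_ge0// (le_trans ler01).
Qed.

(** * Linearity and monotonicity of plane integrals of continuous functions *)

Section plane_integral.
Context {R : realType}.
Variable A : set (R * R).
Hypothesis mA : measurable A.

Let mcont (f : R * R -> R) : continuous f -> measurable_fun A (EFin \o f).
Proof.
move=> cf; apply/measurable_EFinP/measurable_funTS.
exact: continuous_prod_measurable.
Qed.

Lemma ge0_plane_integralD (f g : R * R -> R) :
  continuous f -> continuous g -> (forall p, 0 <= f p) -> (forall p, 0 <= g p) ->
  (\int[mu \x mu]_(p in A) (f p + g p)%:E =
   \int[mu \x mu]_(p in A) (f p)%:E + \int[mu \x mu]_(p in A) (g p)%:E)%E.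
Proof.
move=> cf cg f0 g0; rewrite -ge0_integralD//; try exact: mcont.
- by move=> p _; rewrite lee_fin.
- by move=> p _; rewrite lee_fin.
Qed.

Lemma ge0_plane_integralZl (c : R) (f : R * R -> R) :
  continuous f -> 0 <= c -> (forall p, 0 <= f p) ->
  (\int[mu \x mu]_(p in A) (c * f p)%:E =
   c%:E * \int[mu \x mu]_(p in A) (f p)%:E)%E.
Proof.
move=> cf c0 f0; rewrite -ge0_integralZl_EFin//; try exact: mcont.
by move=> p _; rewrite lee_fin.
Qed.

Lemma ge0_le_plane_integral (f g : R * R -> R) :
  continuous f -> continuous g -> (forall p, 0 <= f p) ->
  (forall p, A p -> f p <= g p) ->
  (\int[mu \x mu]_(p in A) (f p)%:E <= \int[mu \x mu]_(p in A) (g p)%:E)%E.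
Proof.
move=> cf cg f0 fg; apply: ge0_le_integral; try exact: mcont.
- exact: mA.
- by move=> p _; rewrite lee_fin.
- by move=> p Ap; rewrite lee_fin fg.
Qed.

End plane_integral.

(** * Invariance of the quantities in the statement under clamping *)

Lemma supCD_clamp (R : realType) (C D : R) (f : R -> R) :
  supCD C D (f \o clamp C D) = supCD C D f.
Proof.
congr (sup _); apply/seteqP; split => _ [t tCD <-]; exists t => //=;
  by rewrite clamp_id.
Qed.

(** Differentiation is local, and clamping is the identity near an interior point. At the endpoints
    the extension may have a corner, hence the open interval. *)
Lemma is_derive_clamp (R : realType) (C D : R) (f df : R -> R) (t : R) :
  t \in `]C, D[ -> is_derive t 1 f (df t) ->
  is_derive t 1 (f \o clamp C D) ((df \o clamp C D) t).
Proof.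
move=> tCD; rewrite /= clamp_id ?(subset_itv_oo_cc tCD)//.
apply: near_eq_is_derive.
have : \forall x \near t, x \in `]C, D[ by exact: near_in_itvoo.
apply: filterS => x xCD /=.
by rewrite clamp_id ?(subset_itv_oo_cc xCD).
Qed.

Lemma boundary_integral_clamp (R : realType) (C D : R)
    (psi1 psi2 dpsi1 dpsi2 : R -> R) (v : R * R -> R) : C <= D ->
  boundary_integral C D (psi1 \o clamp C D) (psi2 \o clamp C D)
    (dpsi1 \o clamp C D) (dpsi2 \o clamp C D) v =
  boundary_integral C D psi1 psi2 dpsi1 dpsi2 v.
Proof.
move=> CD; have cC : clamp C D C = C by rewrite clamp_id// in_itv/= lexx CD.
have cD : clamp C D D = D by rewrite clamp_id// in_itv/= lexx CD.
rewrite /boundary_integral /= cC cD; congr (_ + _ + _ + _)%E;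
  by apply: eq_integral => t /[!inE] tCD; rewrite clamp_id.
Qed.

Lemma region_clamp (R : realType) (C D : R) (psi1 psi2 : R -> R) :
  region C D (psi1 \o clamp C D) (psi2 \o clamp C D) = region C D psi1 psi2.
Proof.
by apply/seteqP; split => p [pCD]; rewrite /region /= (clamp_id _ _ _ pCD).
Qed.

(** * Assembly of the estimate *)

Theorem theoremB1 (R : realType) (C D : R) (psi1 psi2 dpsi1 dpsi2 : R -> R)
    (v : R * R -> R) :
  C < D ->
  C1_on C D psi1 dpsi1 -> C1_on C D psi2 dpsi2 ->
  (forall t, t \in `[C, D] -> psi1 t < psi2 t) ->
  C1_R2 v ->
  let M := fun t => Num.max `|dpsi1 t| `|dpsi2 t| in
  let a := region C D psi1 psi2 in
  (boundary_integral C D psi1 psi2 dpsi1 dpsi2 v <=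
     (2 * ((D - C)^-1 +
           supCD C D (fun t => (Num.sqrt (1 + M t ^+ 2) + 2 * M t)
                                / (psi2 t - psi1 t))))%:E
       * \int[(@lebesgue_measure R \x @lebesgue_measure R)%E]_(p in a) (`|v p|)%:E
     + (Num.sqrt 2 * (Num.sqrt (1 + supCD C D M ^+ 2) + supCD C D M))%:E
       * \int[(@lebesgue_measure R \x @lebesgue_measure R)%E]_(p in a) (grad_norm v p)%:E)%E.
Proof.
move=> CD C1 C2 p12 [dv [cvy cvt]]; cbv zeta.
set M := fun t => Num.max _ _; set a := region _ _ _ _.
have CD' := ltW CD.
rewrite -boundary_integral_clamp// /a -region_clamp.
set F := fun t => _ / _.
rewrite -(supCD_clamp _ _ _ F) -(supCD_clamp _ _ _ M).
have cq1 := continuous_clamp C D CD' psi1 (C1_on_continuous R C D _ _ CD C1).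
have cq2 := continuous_clamp C D CD' psi2 (C1_on_continuous R C D _ _ CD C2).
have ce1 := continuous_clamp C D CD' dpsi1 C1.2.2.2.2.2.
have ce2 := continuous_clamp C D CD' dpsi2 C2.2.2.2.2.2.
have q1d t : t \in `]C, D[ -> is_derive t 1 (psi1 \o clamp C D) ((dpsi1 \o clamp C D) t).
  by move=> tCD; exact: (is_derive_clamp _ _ _ _ _ _ tCD (C1.1 t tCD)).
have q2d t : t \in `]C, D[ -> is_derive t 1 (psi2 \o clamp C D) ((dpsi2 \o clamp C D) t).
  by move=> tCD; exact: (is_derive_clamp _ _ _ _ _ _ tCD (C2.1 t tCD)).
have q12 t : (psi1 \o clamp C D) t < (psi2 \o clamp C D) t.
  by apply: p12; exact: clamp_itv.
have mE : M \o clamp C D =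
    (fun t => Num.max `|(dpsi1 \o clamp C D) t| `|(dpsi2 \o clamp C D) t|) by [].
have FE : F \o clamp C D =
    (fun t => (Num.sqrt (1 + (M \o clamp C D) t ^+ 2) + 2 * (M \o clamp C D) t)
       / ((psi2 \o clamp C D) t - (psi1 \o clamp C D) t)) by [].
(* The clamped data are replaced by arbitrary functions on the line, retaining global continuity,
   the strict order of the graphs and differentiability inside []C, D[]. *)
move: FE mE; move: (F \o _) (M \o _) => f m.
move: (psi1 \o _) (psi2 \o _) (dpsi1 \o _) (dpsi2 \o _)
  cq1 cq2 ce1 ce2 q1d q2d q12 => q1 q2 e1 e2 cq1 cq2 ce1 ce2 q1d q2d q12 fE mE.
have cm : continuous m.
  by rewrite mE => t; apply: (@continuous_max _ _ (fun t => `|e1 t|) (fun t => `|e2 t|));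
    exact: continuous_norm_comp.
have e1m t : `|e1 t| <= m t by rewrite mE le_max lexx.
have e2m t : `|e2 t| <= m t by rewrite mE le_max lexx orbT.
have m0 t : 0 <= m t by exact: le_trans (e1m t).
have cf : continuous f.
  have qn0 t : q2 t - q1 t != 0 by rewrite subr_eq0 gt_eqF.
  by rewrite fE; cont.
have cv : continuous v by move=> p; exact/differentiable_continuous/dv.
have := graph_integral_le C D q1 q2 e1 e2 m v cq1 cq2 ce1 ce2 cm q12 e1m e2m _
  erefl dv cvy.
have := segment_integral_le C D q1 q2 e1 e2 m v CD cq1 cq2 ce1 ce2 cm q1d q2d
  q12 e1m e2m _ _ erefl erefl dv cvy cvt.
have cgd := continuous_graph_density q1 q2 m v cq1 cq2 cm q12 _ dv cvy.
have csd := continuous_segment_density C D q1 q2 m v cq1 cq2 cm q12 _ _ dv cvy cvt.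
have gd0 := graph_density_ge0 q1 q2 m v q12 (partial_y v).
have sd0 := segment_density_ge0 C D q1 q2 e1 m v CD q12 e1m (partial_y v) (partial_t v).
have mreg := measurable_region C D q1 q2 cq1 cq2.
have cgrad : continuous (grad_norm v).
  exact (continuous_sqrt_comp _ _ _ (continuousD_fun _ _ _ _
    (continuousX_fun _ _ _ 2 cvy) (continuousX_fun _ _ _ 2 cvt))).
move=> segment graph; rewrite /boundary_integral -addeA.
apply: (le_trans (leeD graph segment)).
have f0 t : t \in `[C, D] -> f t <= supCD C D f.
  move=> tCD; apply: le_trans (ler_norm _) _.
  by apply: ler_supCD => //; exact: continuous_subspaceT.
have mS t : t \in `[C, D] -> m t <= supCD C D m.
  move=> tCD; apply: le_trans (ler_norm _) _.
  by apply: ler_supCD => //; exact: continuous_subspaceT.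
(* Evaluation at the point [C] shows that both suprema are nonnegative, as needed to move the
   constants under the integrals. *)
have CCD : C \in `[C, D] by rewrite in_itv/= lexx.
have S0 : 0 <= supCD C D m by exact: le_trans (mS C CCD).
have F0 : 0 <= supCD C D f.
  apply: le_trans (f0 C CCD); rewrite fE divr_ge0//; last by rewrite subr_ge0 ltW.
  by rewrite addr_ge0 ?sqrtr_ge0// mulr_ge0.
have c1_ge0 : 0 <= 2 * ((D - C)^-1 + supCD C D f).
  by rewrite mulr_ge0// addr_ge0// invr_ge0 subr_ge0.
have c2_ge0 : 0 <= Num.sqrt 2 * (Num.sqrt (1 + supCD C D m ^+ 2) + supCD C D m).
  by rewrite mulr_ge0 ?addr_ge0 ?sqrtr_ge0.
have grad_ge0 p : 0 <= grad_norm v p by exact: sqrtr_ge0.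
set c1 := 2 * _ in c1_ge0 *; set c2 := Num.sqrt 2 * _ in c2_ge0 *.
have cnv := continuous_norm_comp _ _ _ cv.
have cc1 := continuousM_fun _ _ _ _ (continuous_cst _ _ c1) cnv.
have cc2 := continuousM_fun _ _ _ _ (continuous_cst _ _ c2) cgrad.
have v0 p : 0 <= `|v p| by exact: normr_ge0.
(* Each side is collected into a single integral over the strip, which reduces the claim to the
   pointwise bound [density_le]. *)
rewrite -(ge0_plane_integralD _ mreg _ _ cgd csd gd0 sd0).
rewrite -(ge0_plane_integralZl _ mreg _ _ cnv c1_ge0 v0).
rewrite -(ge0_plane_integralZl _ mreg _ _ cgrad c2_ge0 grad_ge0).
rewrite -(ge0_plane_integralD _ mreg _ _ cc1 cc2
  (fun p => mulr_ge0 c1_ge0 (v0 p)) (fun p => mulr_ge0 c2_ge0 (grad_ge0 p))).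
apply: (ge0_le_plane_integral _ mreg _ _ (continuousD_fun _ _ _ _ cgd csd)
  (continuousD_fun _ _ _ _ cc1 cc2) (fun p => addr_ge0 (gd0 p) (sd0 p))).
move=> p [pCD _]; apply: density_le => //; first exact: mS.
by have := f0 _ pCD; rewrite fE.
Qed.
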